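(* For every integer $n\geq 4$, $r(K_{3}, F_{4,n})=8n+1$ and $r_{\ast}(K_{3}, F_{4,n})=4n+4$.
   Context: For graphs $G,H$, the Ramsey number $r(G,H)$ is the least integer $r$ such that every red/blue edge-coloring of the complete graph $K_r$ contains a red copy of $G$ or a blue copy of $H$. For $r=r(G,H)$, let $K_{r-1}\sqcup S_{k}$ denote the graph obtained from $K_{r-1}$ by adding a new vertex $v$ and joining $v$ by edges to exactly $k$ vertices of $K_{r-1}$; the star-critical Ramsey number $r_{\ast}(G,H)$ is the least integer $k$ such that every red/blue edge-coloring of $K_{r-1}\sqcup S_{k}$ contains a red copy of $G$ or a blue copy of $H$. The generalized fan $F_{t,n}$ is $K_1+nK_t$, the join of a single vertex with the disjoint union of $n$ copies of the complete graph $K_t$. *)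

(* Defs.v *)
From mathcomp Require Import all_boot.

Set Implicit Arguments.
Unset Strict Implicit.
Unset Printing Implicit Defensive.

Record sgraph := SGraph {
  vertex :> finType;
  adj : rel vertex;
  adj_sym : symmetric adj;
  adj_irrefl : irreflexive adj
}.

Section Complete.
Variable m : nat.

Definition complete_adj : rel 'I_m := fun i j => i != j.

Lemma complete_sym : symmetric complete_adj.
Proof. by move=> i j; rewrite /complete_adj eq_sym. Qed.

Lemma complete_irrefl : irreflexive complete_adj.
Proof. by move=> i; rewrite /complete_adj eqxx. Qed.

Definition complete : sgraph := SGraph complete_sym complete_irrefl.
End Complete.

Section Join.
Variables G H : sgraph.

Definition join_adj : rel (G + H)%type := fun x y =>
  match x, y with
  | inl a, inl b => adj a b
  | inr a, inr b => adj a b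
  | _, _ => true
  end.

Lemma join_sym : symmetric join_adj.
Proof. by move=> [x|x] [y|y] //=; apply: adj_sym. Qed.

Lemma join_irrefl : irreflexive join_adj.
Proof. by move=> [x|x] /=; apply: adj_irrefl. Qed.

Definition join : sgraph := SGraph join_sym join_irrefl.
End Join.

(* copies n G is the disjoint union nG; the vertex (i, x) is x in copy i. *)
Section Copies.
Variables (n : nat) (G : sgraph).

Definition copies_adj : rel ('I_n * G)%type := fun x y =>
  (x.1 == y.1) && adj x.2 y.2.

Lemma copies_sym : symmetric copies_adj.
Proof. by move=> x y; rewrite /copies_adj eq_sym adj_sym. Qed.

Lemma copies_irrefl : irreflexive copies_adj.
Proof. by move=> x; rewrite /copies_adj adj_irrefl andbF. Qed.

Definition copies : sgraph := SGraph copies_sym copies_irrefl.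
End Copies.

Definition fan (t n : nat) : sgraph :=
  join (complete 1) (copies n (complete t)).

(* complete_star N k is K_N with a new vertex None joined to the k vertices
   0, ..., k-1 of K_N; it is meant for k <= N (for k > N it is K_(N+1)). Up to
   isomorphism the choice of the k neighbours is immaterial. *)
Section CompleteStar.
Variables N k : nat.

Definition complete_star_adj : rel (option 'I_N) := fun x y =>
  match x, y with
  | Some i, Some j => i != j
  | Some i, None | None, Some i => i < k
  | None, None => false
  end.

Lemma complete_star_sym : symmetric complete_star_adj.
Proof. by move=> [i|] [j|] //=; rewrite eq_sym. Qed.

Lemma complete_star_irrefl : irreflexive complete_star_adj.
Proof. by move=> [i|] //=; rewrite eqxx. Qed.

Definition complete_star : sgraph :=
  SGraph complete_star_sym complete_star_irrefl.
End CompleteStar.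

(* A red/blue edge-coloring of G is c : {set G} -> bool, the edge xy having
   color c [set x; y], with true for red and false for blue; the values of c
   on sets that are not edges of G are irrelevant. *)
Section ColorClass.
Variables (G : sgraph) (c : {set G} -> bool) (b : bool).

Definition color_adj : rel G := fun x y => adj x y && (c [set x; y] == b).

Lemma color_sym : symmetric color_adj.
Proof. by move=> x y; rewrite /color_adj adj_sym setUC. Qed.

Lemma color_irrefl : irreflexive color_adj.
Proof. by move=> x; rewrite /color_adj adj_irrefl. Qed.

Definition color_class : sgraph := SGraph color_sym color_irrefl.
End ColorClass.

(* Copies are subgraphs, not necessarily induced. *)
Definition contains_copy (F G : sgraph) : Prop :=
  exists f : G -> F, injective f /\ {homo f : x y / adj x y}.

Definition arrows (F G H : sgraph) : Prop :=
  forall c : {set F} -> bool,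
    contains_copy (color_class c true) G \/
    contains_copy (color_class c false) H.

Definition is_least (P : nat -> Prop) (m : nat) : Prop :=
  P m /\ forall k, P k -> m <= k.

Definition ramsey_number (G H : sgraph) (r : nat) : Prop :=
  is_least (fun m => arrows (complete m) G H) r.

Definition star_critical_ramsey_number (G H : sgraph) (s : nat) : Prop :=
  exists2 r, ramsey_number G H r &
    is_least (fun k => k <= r.-1 /\ arrows (complete_star r.-1 k) G H) s.

(* Main.v *)
Require Import Defs.
From mathcomp Require Import all_boot.
From mathcomp Require Import zify.

(** Colouring by a balanced cut gives both lower bounds: a blue fan lies on one
    side of the cut, and in the star version it would have to use the new
    vertex, which has at most three blue neighbours.

    For the upper bounds it is enough to treat [complete_star (8 * n)
    (4 * n + 4)], a subgraph of [complete (8 * n + 1)]. Suppose there is no red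
    triangle. A triangle-free graph on [4 * n + 3] vertices contains [n]
    disjoint independent 4-sets (from [11] vertices on, such sets are removed
    greedily; the case of [11] vertices and two sets is a finite search). Hence
    a vertex with at most [4 * n - 4] red neighbours is the centre of a blue
    fan. If all red degrees are at least [4 * n - 3], then, since [n >= 4], the
    red graph on the [8 * n] vertices has no closed 5-walk and is bipartite
    with parts of size [4 * n], both of them blue cliques. The extra vertex
    then has four blue neighbours in one of the parts: otherwise it has red
    neighbours in both, and the large red degrees leave too few of them. *)

Set Implicit Arguments.
Unset Strict Implicit.
Unset Printing Implicit Defensive.

(** * Exhaustive search over Boolean valuations *)

Section Covering.
Variables (A : Type) (eqA : rel A).
Hypothesis eqAP : Equality.axiom eqA.
Implicit Types (v : A -> bool) (p : seq (A * bool)) (ps : seq (seq (A * bool))).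

(** A pattern is a conjunction of literals and a list of patterns their disjunction; [covers]
    certifies that this disjunction is a tautology. *)
Definition realized v p := all (fun l => v l.1 == l.2) p.

Definition agrees (x : A) (b : bool) p :=
  all (fun l => if eqA l.1 x then (if b then l.2 else ~~ l.2) else true) p.

Definition assign (x : A) (b : bool) ps :=
  [seq [seq l <- p | ~~ eqA l.1 x] | p <- ps & agrees x b p].

Fixpoint shorter (p q : seq (A * bool)) :=
  match p, q with
  | _, [::] => false
  | [::], _ => true
  | _ :: p', _ :: q' => shorter p' q'
  end.

Definition shortest p ps :=
  foldl (fun p q => if shorter q p then q else p) p ps.

(* Case analysis on the first variable of a shortest pattern: patterns with a
   single literal left act as unit clauses. *)
Fixpoint covers (fuel : nat) ps : bool :=
  match fuel, ps with
  | f.+1, p :: ps' =>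
      if shortest p ps' is (x, _) :: _ then
        if covers f (assign x true ps) then covers f (assign x false ps)
        else false
      else true
  | _, _ => false
  end.

(** The literals deleted by [assign] are about [x] and agree with [v x], so a valuation that
    realizes a reduced pattern realizes the original one. *)
Lemma realized_assign v x ps :
  has (realized v) (assign x (v x) ps) -> has (realized v) ps.
Proof.
rewrite /assign has_map; elim: ps => //= p ps IH; case: ifP => /= [ag|_ /IH->].
  case/orP=> [vp|/IH->]; last by rewrite orbT.
  apply/orP; left; elim: p ag vp {IH} => //= -[y b] p IH /= /andP[+ /IH{}IH].
  by case: eqAP => /= [->|_] + => [|_ /andP[-> /IH]//]; case: (v x) b => -[].
by rewrite orbT.
Qed.

Lemma shortest_realized v p ps :
  realized v (shortest p ps) -> has (realized v) (p :: ps).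
Proof.
elim: ps p => [|q ps IH] p /=; first by rewrite orbF.
by move/IH; case: ifP => _ /= /orP[->|->]; rewrite ?orbT.
Qed.

Lemma coversP v fuel ps : covers fuel ps -> has (realized v) ps.
Proof.
elim: fuel ps => // f IH [|p ps] // /[dup].
rewrite {1}/covers -/covers; case E: shortest => [|[x b] q].
  (* An empty pattern is realized by every valuation. *)
  by move=> _ _; apply: shortest_realized; rewrite E.
case: ifP => // /IH tps /IH fps _.
by apply: (@realized_assign v x); case: (v x).
Qed.

End Covering.

(** * Search over graphs on at most eleven vertices *)

(* A variable [(i, j)] with [j < i] stands for the pair of the [i]-th and [j]-th
   vertices of a list; it is [true] when they are adjacent. Comparing the small
   components first keeps the search fast. *)
Definition pair_eqb (x y : nat * nat) :=
  if eqn x.2 y.2 then eqn x.1 y.1 else false.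

Lemma pair_eqbP : Equality.axiom pair_eqb.
Proof.
move=> [i j] [i' j']; rewrite /pair_eqb /=.
apply: (iffP idP) => [|[-> ->]]; last by rewrite !eqnE !eqxx.
by case: eqnP => // -> /eqnP->.
Qed.

Definition pairs n := [seq (i, j) | i <- rev (iota 0 n), j <- rev (iota 0 i)].

Lemma mem_pairs n i j : ((i, j) \in pairs n) = (j < i < n).
Proof.
apply/allpairsPdep/idP => [[i' [j' []]]|/andP[ji ni]].
  by rewrite !mem_rev !mem_iota => ? ? [-> ->]; lia.
by exists i, j; rewrite !mem_rev !mem_iota; split=> //; lia.
Qed.

Definition pattern n (b : bool) (f : pred (nat * nat)) :=
  [seq (ij, b) | ij <- pairs n & f ij].

Definition among (s : seq nat) (ij : nat * nat) := (ij.1 \in s) && (ij.2 \in s).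

Fixpoint subseqs k (s : seq nat) : seq (seq nat) :=
  match k, s with
  | 0, _ => [:: [::]]
  | _.+1, [::] => [::]
  | k'.+1, x :: s' => [seq x :: t | t <- subseqs k' s'] ++ subseqs k s'
  end.

Lemma mem_subseqs k s t : t \in subseqs k s -> size t = k /\ subseq t s.
Proof.
elim: s k t => [|x s IH] [|k] t //=; try by rewrite inE => /eqP->.
rewrite mem_cat => /orP[/mapP[u /IH[<- us] ->]|/IH[<- ts]].
  by rewrite /= eqxx.
by split=> //; apply: subseq_trans ts (subseq_cons _ _).
Qed.

(** Used for triangles ([true], 3) and independent 4-sets ([false], 4) among the first [m] of [n]
    vertices. *)
Definition mono n m b k :=
  [seq pattern n b (among s) | s <- subseqs k (iota 0 m)].

Definition edge i j := (maxn i j, minn i j).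

(* Excluded once the neighbours of vertex 0 are listed before its
   non-neighbours. *)
Definition sorted_row n :=
  [seq [:: ((j.+1, 0), true); ((j, 0), false)] | j <- iota 1 n.-2].

Definition cycle_edges (c : seq nat) :=
  [seq edge ij.1 ij.2 | ij <- zip c (rot 1 c)].

(** The filter starts a cycle at its smallest vertex and fixes its direction, so that each cycle is
    listed once. *)
Definition cycles n k :=
  [seq [seq (e, true) | e <- cycle_edges c]
     | c <- flatten [seq permutations s | s <- subseqs k (iota 0 n)]
         & all (leq (head 0 c)) c && (nth 0 c 1 < last 0 c)].

(** Counting the opposite colour of each pair as covered lets the search assume colour [b] on all of
    [es]. *)
Definition forced (b : bool) (es : seq (nat * nat)) :
    seq (seq (nat * nat * bool)) :=
  [seq [:: (e, ~~ b)] | e <- es].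

(* Vertices 7 to 10 form an independent set; the pairs of 4-sets selected by
   the filter are the ones that the search needs. *)
Definition two_quads :=
  [seq pattern 11 false (fun ij => among s ij || among t ij)
    | s <- subseqs 4 (iota 0 11),
      t <- [seq t <- subseqs 4 [seq i <- iota 0 11 | i \notin s] |
             let a := count (leq 7) s in let b := count (leq 7) t in
             [&& head 0 s < head 0 t, 0 < a, 0 < b & ~~ odd (a + b)]]].

Definition base11 :=
  forced false [seq ij <- pairs 11 | among (iota 7 4) ij] ++
  two_quads ++ mono 11 7 false 4 ++ mono 11 11 true 3.

(** The Ramsey bound r(K_3, K_4) <= 10. Each case split removes a variable, and eleven vertices have
    only 55 pairs, so fuel 60 suffices here and below. *)
Lemma covers_quad :
  covers pair_eqb 60 (sorted_row 10 ++ mono 10 10 true 3 ++ mono 10 10 false 4).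
Proof. by vm_compute. Qed.

(** A bipartite graph on seven vertices has a side with at least four of them; otherwise a shortest
    odd cycle has length 5 or 7, triangles being excluded. *)
Lemma covers_odd_cycle :
  covers pair_eqb 60 (sorted_row 7 ++ mono 7 7 true 3 ++ mono 7 7 false 4 ++
    cycles 7 5 ++ cycles 7 7).
Proof. by vm_compute. Qed.

(** Vertices 0 to 4 form a pentagon, and the neighbours of vertex 5 on it are among 1 and 4. *)
Lemma covers_pentagon :
  covers pair_eqb 60 (forced true (cycle_edges (iota 0 5)) ++
    forced false [:: (5, 0); (5, 2); (5, 3)] ++ base11).
Proof. by vm_compute. Qed.

(** A chord of a triangle-free heptagon closes five consecutive vertices into a pentagon. Such
    pentagons count as covered, since the previous search settles them. *)
Lemma covers_heptagon :
  covers pair_eqb 60 (forced true (cycle_edges (iota 0 7)) ++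
    [seq [seq (e, true) | e <- cycle_edges (take 5 (rot i (iota 0 7)))]
       | i <- iota 0 7] ++ base11).
Proof. by vm_compute. Qed.

(** * Packing independent 4-sets in triangle-free graphs *)

(* [rewrite has_cat] would evaluate the lists of patterns while matching. *)
Lemma has_catP (A : Type) (p : pred A) s t :
  has p (s ++ t) -> has p s \/ has p t.
Proof. by rewrite has_cat => /orP. Qed.

Section TriangleFree.
Variables (T : eqType) (r : rel T).
Hypothesis r_sym : symmetric r.
Hypothesis r_tf : forall x y z, r x y -> r y z -> r z x -> False.
Implicit Types (q l : seq T) (s : seq nat).

Definition indep q := {in q &, forall x y, ~~ r x y}.

Definition packing n l := exists ss : seq (seq T),
  [/\ size ss = n, {in ss, forall q, size q = 4 /\ indep q},
      uniq (flatten ss) & {subset flatten ss <= l}].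

(** A loop is a degenerate triangle, which [r_tf] forbids as well. *)
Lemma r_irr x : r x x = false.
Proof. by apply/negP => rxx; apply: (r_tf rxx rxx). Qed.

Lemma indep_nbrs x l : indep [seq y <- l | r x y].
Proof.
move=> y z; rewrite !mem_filter => /andP[xy _] /andP[xz _].
by apply/negP => yz; apply: (r_tf xy yz); rewrite r_sym.
Qed.

Lemma sub_indep q l : {subset q <= l} -> indep l -> indep q.
Proof. by move=> ql il x y /ql xl /ql; apply: il. Qed.

Lemma sub_packing n l l' : {subset l <= l'} -> packing n l -> packing n l'.
Proof. by move=> ll' [ss [? ? ? sl]]; exists ss; split=> // x /sl/ll'. Qed.

Lemma packing_cons n q l : uniq q -> size q = 4 -> indep q -> {subset q <= l} ->
  packing n [seq x <- l | x \notin q] -> packing n.+1 l.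
Proof.
move=> uq sq iq ql [ss [sss qss uss ssl]]; exists (q :: ss); split=> /=.
- by rewrite sss.
- by move=> q'; rewrite inE => /predU1P[->//|/qss].
- rewrite cat_uniq uq uss andbT; apply/hasPn => x /ssl.
  by rewrite mem_filter => /andP[].
move=> x; rewrite mem_cat => /orP[/ql//|/ssl].
by rewrite mem_filter => /andP[].
Qed.

Lemma packing0 l : packing 0 l.
Proof. by exists [::]. Qed.

Lemma size_removed q l : uniq q -> uniq l -> {subset q <= l} ->
  size [seq x <- l | x \notin q] = size l - size q.
Proof.
move=> uq ul ql; rewrite size_filter -[size l](count_predC (mem q)).
have -> : count (mem q) l = size q; last by rewrite addKn.
rewrite -size_filter; apply/perm_size/uniq_perm; rewrite ?filter_uniq // => x.
by rewrite mem_filter /=; case: (boolP (x \in q)) => // /ql.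
Qed.

Lemma indep_packing n l : uniq l -> indep l -> 4 * n <= size l -> packing n l.
Proof.
elim: n l => [|n IH] l ul il sl; first exact: packing0.
have tl : {subset take 4 l <= l} by move=> x /mem_take.
have st : size (take 4 l) = 4 by rewrite size_takel //; lia.
apply: (packing_cons (q := take 4 l)) => //; first exact: take_uniq.
  exact: sub_indep il.
apply: IH; first exact: filter_uniq.
  by apply: sub_indep il => x; rewrite mem_filter => /andP[].
by rewrite size_removed ?take_uniq // st; lia.
Qed.

(** * Translation of covered patterns into vertices of a list *)

Section Embedding.
Variables (x0 : T) (l : seq T).
Hypothesis l_uniq : uniq l.

Let g i := nth x0 l i.
Let ev (ij : nat * nat) := r (g ij.1) (g ij.2).

Lemma ev_edge i j : ev (edge i j) = r (g i) (g j).
Proof. by rewrite /ev /edge /=; case: (leqP i j) => _; rewrite 1?r_sym. Qed.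

Lemma realized_pattern n b (f : pred (nat * nat)) s :
  realized ev (pattern n b f) -> {subset s <= iota 0 n} ->
  subpred (among s) f ->
  {in s &, forall i j, i != j -> r (g i) (g j) = b}.
Proof.
move=> /allP evP sn sf i j si sj ij.
rewrite -ev_edge; apply/eqP.
have me : edge i j \in pairs n.
  by rewrite mem_pairs; move: (sn _ si) (sn _ sj); rewrite !mem_iota; lia.
apply: (evP (edge i j, b)); apply: map_f; rewrite mem_filter me andbT.
by apply: sf; rewrite /among /edge /=; case: (leqP i j) => _; rewrite si sj.
Qed.

Lemma indep_realized n (f : pred (nat * nat)) s :
  realized ev (pattern n false f) -> {subset s <= iota 0 n} ->
  subpred (among s) f -> indep (map g s).
Proof.
move=> rp sn sf _ _ /mapP[i si ->] /mapP[j sj ->].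
have [->|ij] := eqVneq i j; first by rewrite r_irr.
by rewrite (realized_pattern rp sn sf).
Qed.

Lemma map_g_uniq s : {subset s <= iota 0 (size l)} -> uniq s -> uniq (map g s).
Proof.
move=> sl us; rewrite map_inj_in_uniq // => i j /sl + /sl.
by rewrite !mem_iota /= => il jl /eqP; rewrite nth_uniq // => /eqP.
Qed.

Lemma map_g_sub s : {subset s <= iota 0 (size l)} -> {subset map g s <= l}.
Proof.
by move=> sl _ /mapP[i /sl + ->]; rewrite mem_iota /= => ?; apply: mem_nth.
Qed.

Lemma subseqs_spec k m n s : m <= n -> s \in subseqs k (iota 0 m) ->
  [/\ size s = k, uniq s & {subset s <= iota 0 n}].
Proof.
move=> mn /mem_subseqs[ss sm]; split=> //.
  exact: subseq_uniq sm (iota_uniq _ _).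
by move=> i /(mem_subseq sm); rewrite !mem_iota; lia.
Qed.

Lemma no_realized_triangle n : ~~ has (realized ev) (mono n n true 3).
Proof.
apply/hasPn => _ /mapP[s /subseqs_spec-/(_ n (leqnn _))[+ us sn] ->].
case: s us sn => [|a [|b [|c []]]] //= us sn _; apply/negP => rp.
have rP := realized_pattern rp sn (fun _ => id).
move: us; rewrite !inE !negb_or => /and3P[/andP[ab ac] bc _].
apply: (r_tf (rP a b _ _ ab) (rP b c _ _ bc) (rP c a _ _ _));
  by rewrite ?inE ?eqxx ?orbT // eq_sym.
Qed.

Lemma realized_quad n m : m <= n -> n <= size l ->
  has (realized ev) (mono n m false 4) ->
  exists q, [/\ uniq q, size q = 4, indep q & {subset q <= take m l}].
Proof.
move=> mn nl /hasP[_ /mapP[s sm ->] rp].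
have [ss us sn] := subseqs_spec mn sm.
have [_ _ sm'] := subseqs_spec (leqnn m) sm.
have sl : {subset s <= iota 0 (size l)}.
  by move=> i /sn; rewrite !mem_iota; lia.
exists (map g s); split; rewrite ?size_map ?map_g_uniq //.
  exact: indep_realized rp sn (fun _ => id).
move=> _ /mapP[i /sm' + ->]; rewrite mem_iota /= => im.
by rewrite /g -(nth_take x0 im) mem_nth // size_takel //; lia.
Qed.

Lemma realized_two_quads : size l = 11 -> has (realized ev) two_quads ->
  packing 2 l.
Proof.
move=> sl /hasP[_ /allpairsPdep[s [t [s4 + ->]]] rp].
rewrite mem_filter => /andP[_ t4].
have [ss us sn] := subseqs_spec (leqnn 11) s4.
have [st tsub] := mem_subseqs t4.
have tn : {subset t <= iota 0 11}.
  by move=> i /(mem_subseq tsub); rewrite mem_filter => /andP[].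
have ut : uniq t by rewrite (subseq_uniq tsub) // filter_uniq // iota_uniq.
have stn : {subset s ++ t <= iota 0 (size l)}.
  by move=> i; rewrite mem_cat sl => /orP[/sn|/tn].
exists [:: map g s; map g t]; split=> //=.
- move=> q; rewrite !inE => /orP[] /eqP->; rewrite size_map; split=> //.
    by apply: (indep_realized rp sn) => ij; rewrite /= => ->.
  by apply: (indep_realized rp tn) => ij; rewrite /= => ->; rewrite orbT.
- rewrite cats0 -map_cat map_g_uniq // cat_uniq us ut andbT.
  by apply/hasPn => i /(mem_subseq tsub); rewrite mem_filter => /andP[].
by rewrite cats0 -map_cat; apply: map_g_sub.
Qed.

Lemma realized_cycle c : realized ev [seq (e, true) | e <- cycle_edges c] ->
  cycle r (map g c).
Proof.
case: c => [|a c] //; rewrite /cycle_edges rot1_cons [cycle _ _]/=.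
suff rP z : realized ev [seq (e, true) | e <- [seq edge ij.1 ij.2 |
    ij <- zip (a :: c) (rcons c z)]] -> path r (g a) (rcons (map g c) (g z)).
  exact: rP.
elim: c a => [|b c IH] a /=; rewrite ev_edge eqb_id ?andbT //.
by case/andP=> -> /IH.
Qed.

Lemma realized_forced b es : all (fun e => ev e == b) es ->
  ~~ has (realized ev) (forced b es).
Proof.
move=> /allP eb; apply/hasPn => _ /mapP[e /eb/eqP ee ->] /=.
by rewrite ee; case: b {eb ee}.
Qed.

Lemma realized_base : size l = 11 -> indep (drop 7 l) ->
  has (realized ev) base11 -> packing 2 l.
Proof.
move=> sl iS; rewrite /base11 => /has_catP[fS|/has_catP[tq|/has_catP[tq|tr]]].
- suff /negP[] : ~~ has (realized ev)
    (forced false [seq ij <- pairs 11 | among (iota 7 4) ij]) by [].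
  apply/realized_forced/allP => -[i j]; rewrite mem_filter mem_pairs => /andP[].
  rewrite /among !mem_iota /= => ij _; rewrite eqbF_neg.
  have m k : 6 < k < 7 + 4 -> g k \in drop 7 l.
    move=> /andP[k7 k11]; rewrite /g -(subnKC k7) -nth_drop mem_nth //.
    by rewrite size_drop sl; lia.
  by case/andP: ij => i7 j7; apply: iS; apply: m.
- exact: realized_two_quads.
(* The independent 4-set found lies among the first seven vertices; the tail [drop 7 l] is the
   second one. *)
- have [q [uq sq iq qT]] := realized_quad (isT : 7 <= 11) (eq_leq (esym sl)) tq.
  apply: (packing_cons (q := q)) => //; first by move=> x /qT/mem_take.
  apply: (sub_packing (l := drop 7 l)); last first.
    by apply: indep_packing; rewrite ?drop_uniq // size_drop sl.
  move=> x xd; rewrite mem_filter (mem_drop xd) andbT; apply/negP => /qT xt.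
  move: l_uniq; rewrite -(cat_take_drop 7 l) cat_uniq => /and3P[_ + _].
  by move/hasPn/(_ x xd)/negP; apply.
- by have := no_realized_triangle 11; rewrite tr.
Qed.

Lemma realized_cycles n k : n <= size l -> has (realized ev) (cycles n k) ->
  exists c, [/\ uniq c, size c = k, cycle r c & {subset c <= l}].
Proof.
move=> nl /hasP[_ /mapP[c + ->] /realized_cycle gc]; rewrite mem_filter.
case/andP=> _ /flatten_mapP[s /subseqs_spec-/(_ n (leqnn _))[ss us sn]].
rewrite mem_permutations => cs; have cl : {subset c <= iota 0 (size l)}.
  by move=> i; rewrite (perm_mem cs) => /sn; rewrite !mem_iota; lia.
exists (map g c); split=> //; last exact: map_g_sub.
  by rewrite map_g_uniq // (perm_uniq cs).
by rewrite size_map (perm_size cs).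
Qed.

End Embedding.

Lemma realized_sorted_row x a b :
  {in a, forall y, r x y} -> {in b, forall y, ~~ r x y} ->
  ~~ has (realized (fun ij =>
            r (nth x (x :: a ++ b) ij.1) (nth x (x :: a ++ b) ij.2)))
       (sorted_row (size (a ++ b)).+1).
Proof.
move=> ra rb; apply/hasPn => _ /mapP[[|j] + ->] /=; rewrite mem_iota // => js.
rewrite !(r_sym _ x) andbT; apply/negP => /andP[/eqP + /eqP].
have {js} : j.+1 < size (a ++ b) by lia.
rewrite size_cat !nth_cat; case: (ltnP j.+1 (size a)) => ja js.
  by rewrite (ltnW ja) (ra _ (mem_nth _ (ltnW ja))).
by rewrite (negbTE (rb _ (mem_nth _ _))) //; lia.
Qed.

(** Moving the neighbours of the first vertex forward is harmless, since the results sought depend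
    only on the members of the list. *)
Lemma sorted_row_wlog l n : uniq l -> size l = n.+1 -> exists x0 l',
  perm_eq l' l /\
  ~~ has (realized (fun ij => r (nth x0 l' ij.1) (nth x0 l' ij.2)))
       (sorted_row n.+1).
Proof.
case: l => // x s ul [sn].
exists x, (x :: [seq y <- s | r x y] ++ [seq y <- s | ~~ r x y]); split.
  by rewrite perm_cons; apply/permPl/perm_filterC.
have := @realized_sorted_row x [seq y <- s | r x y] [seq y <- s | ~~ r x y].
rewrite (perm_size (permEl (perm_filterC (r x) s))) sn; apply;
  by move=> y; rewrite mem_filter => /andP[].
Qed.

Lemma indep_quad l : uniq l -> 10 <= size l ->
  exists q, [/\ uniq q, size q = 4, indep q & {subset q <= l}].
Proof.
move=> ul sl; have st : size (take 10 l) = 10 by rewrite size_takel.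
have [x0 [l' [pl nsr]]] := sorted_row_wlog (take_uniq 10 ul) st.
have sl' : 10 <= size l' by rewrite (perm_size pl) st.
have ul' : uniq l' by rewrite (perm_uniq pl) take_uniq.
have := coversP pair_eqbP
  (fun ij => r (nth x0 l' ij.1) (nth x0 l' ij.2)) covers_quad.
case/has_catP=> [sr|/has_catP[tr|qd]].
- by rewrite sr in nsr.
- by have := no_realized_triangle x0 ul' 10; rewrite tr.
have [q [uq sq iq qT]] := realized_quad ul' (leqnn 10) sl' qd.
by exists q; split=> // x /qT/mem_take; rewrite (perm_mem pl) => /mem_take.
Qed.

Lemma odd_cycle_or_quad l : uniq l -> size l = 7 ->
  (exists q, [/\ uniq q, size q = 4, indep q & {subset q <= l}]) \/
  (exists c,
     [/\ uniq c, size c = 5 \/ size c = 7, cycle r c & {subset c <= l}]).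
Proof.
move=> ul sl; have [x0 [l' [pl nsr]]] := sorted_row_wlog ul sl.
have sl' : 7 <= size l' by rewrite (perm_size pl) sl.
have ul' : uniq l' by rewrite (perm_uniq pl).
have := coversP pair_eqbP
  (fun ij => r (nth x0 l' ij.1) (nth x0 l' ij.2)) covers_odd_cycle.
case/has_catP=> [sr|/has_catP[tr|/has_catP[qd|cs]]].
- by rewrite sr in nsr.
- by have := no_realized_triangle x0 ul' 7; rewrite tr.
- left; have [q [uq sq iq qT]] := realized_quad ul' (leqnn 7) sl' qd.
  by exists q; split=> // x /qT/mem_take; rewrite (perm_mem pl).
right; case/has_catP: cs => /(realized_cycles ul' sl')[c [uc sc cc cl]];
  by exists c; split=> //; [auto | move=> x /cl; rewrite (perm_mem pl)].
Qed.

Lemma pentagon_fixed_packing c0 c1 c2 c3 c4 x y S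
    (l := [:: c0, c1, c2, c3, c4, x, y & S]) :
  uniq l -> size S = 4 -> indep S -> cycle r [:: c0; c1; c2; c3; c4] ->
  ~~ r x c0 -> ~~ r x c2 -> ~~ r x c3 -> packing 2 l.
Proof.
move=> ul sS iS /= /and5P[r01 r12 r23 r34 /andP[r40 _]] x0 x2 x3.
have := coversP pair_eqbP
  (fun ij => r (nth x l ij.1) (nth x l ij.2)) covers_pentagon.
case/has_catP=> [rc|/has_catP[rc|]]; last first.
- by apply: realized_base => //=; rewrite ?sS ?drop0.
- exfalso; move: rc; apply/negP; apply: realized_forced => /=.
  by rewrite !eqbF_neg x0 x2 x3.
exfalso; move: rc; apply/negP; apply: realized_forced => /=.
by rewrite (r_sym c1 c0) (r_sym c2 c1) (r_sym c3 c2) (r_sym c4 c3)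
  r01 r12 r23 r34 r40.
Qed.

(** A vertex [x] off the pentagon is never adjacent to two consecutive vertices of it, so a rotation
    brings its neighbours among [c1] and [c4], the configuration of [pentagon_fixed_packing]. *)
Lemma pentagon_packing l S c : uniq (l ++ S) -> size l = 7 -> size S = 4 ->
  indep S -> uniq c -> size c = 5 -> cycle r c -> {subset c <= l} ->
  packing 2 (l ++ S).
Proof.
move=> uS sl sS iS uc sc cc cl.
have ul : uniq l by move: uS; rewrite cat_uniq => /andP[].
have := size_removed uc ul cl; rewrite sl sc.
case E: [seq z <- l | z \notin c] => [|x [|y []]] // _.
have pl : perm_eq (c ++ [:: x; y]) l.
  rewrite -E; apply: uniq_perm => //.
    rewrite cat_uniq uc filter_uniq // andbT; apply/hasPn => z.
    by rewrite mem_filter => /andP[].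
  move=> z; rewrite mem_cat mem_filter; case: (boolP (z \in c)) => //= zc.
  by rewrite cl.
have pk c' : perm_eq c' c -> packing 2 (c' ++ [:: x, y & S]) ->
    packing 2 (l ++ S).
  move=> pc; apply: sub_packing => z.
  rewrite -[[:: x, y & S]]/([:: x; y] ++ S) catA !mem_cat -(perm_mem pl).
  by rewrite mem_cat (perm_mem pc).
have uk c' : perm_eq c' c -> uniq (c' ++ [:: x, y & S]).
  move=> pc; rewrite -(perm_uniq (perm_cat pl (perm_refl S))) in uS.
  by rewrite -catA in uS; rewrite (perm_uniq (perm_cat pc (perm_refl _))).
case: c sc cc pk uk {uc cl pl E} => [|c0 [|c1 [|c2 [|c3 [|c4 []]]]]] // _.
rewrite /= andbT => /and5P[r01 r12 r23 r34 r40] pk uk.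
have nr u v : r u v -> ~~ (r x u && r x v).
  by move=> uv; apply/negP => /andP[xu xv]; apply: (r_tf xu uv); rewrite r_sym.
(* The five rotations of the triple of non-neighbours. *)
have: [|| [&& ~~ r x c0, ~~ r x c2 & ~~ r x c3],
          [&& ~~ r x c1, ~~ r x c3 & ~~ r x c4],
          [&& ~~ r x c2, ~~ r x c4 & ~~ r x c0],
          [&& ~~ r x c3, ~~ r x c0 & ~~ r x c1] |
          [&& ~~ r x c4, ~~ r x c1 & ~~ r x c2]].
  move: (nr _ _ r01) (nr _ _ r12) (nr _ _ r23) (nr _ _ r34) (nr _ _ r40).
  by do 5!case: (r x _).
have pr i : perm_eq (rot i [:: c0; c1; c2; c3; c4]) [:: c0; c1; c2; c3; c4].
  by rewrite perm_rot.
case/or4P=> [|||/orP[]] /and3P[n1 n2 n3];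
  [apply: (pk _ (pr 0)) | apply: (pk _ (pr 1)) | apply: (pk _ (pr 2)) |
   apply: (pk _ (pr 3)) | apply: (pk _ (pr 4))];
  by apply: pentagon_fixed_packing; rewrite /= ?r01 ?r12 ?r23 ?r34 ?r40 //;
     first [exact: (uk _ (pr 0)) | exact: (uk _ (pr 1)) | exact: (uk _ (pr 2)) |
       exact: (uk _ (pr 3)) | exact: (uk _ (pr 4))].
Qed.

Lemma heptagon_packing c S : uniq (c ++ S) -> size c = 7 -> size S = 4 ->
  indep S -> cycle r c -> packing 2 (c ++ S).
Proof.
move=> uS sc sS iS cc; set l := c ++ S.
have [x0 _] : exists x : T, True by case: c sc {uS cc l} => // x; exists x.
have := coversP pair_eqbP
  (fun ij => r (nth x0 l ij.1) (nth x0 l ij.2)) covers_heptagon.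
have sl : size l = 11 by rewrite size_cat sc sS.
case/has_catP=> [rc|/has_catP[|]]; last first.
- by apply: realized_base; rewrite // drop_size_cat.
(* A pentagon inside the heptagon reduces to [pentagon_packing]. *)
- case/hasP=> _ /mapP[i i7 ->] /(@realized_cycle x0 l).
  have s7 : {subset take 5 (rot i (iota 0 7)) <= iota 0 7}.
    by move=> j /mem_take; rewrite mem_rot.
  have sl7 : {subset take 5 (rot i (iota 0 7)) <= iota 0 (size l)}.
    by move=> j /s7; rewrite !mem_iota sl; lia.
  move=> cyc5; apply: (@pentagon_packing c S _ uS sc sS iS _ _ cyc5).
  - by apply: map_g_uniq => //; rewrite take_uniq // rot_uniq iota_uniq.
  - by rewrite size_map size_takel // size_rot size_iota.
  move=> _ /mapP[j /s7 + ->]; rewrite mem_iota /= => j7.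
  by rewrite nth_cat sc j7 mem_nth // sc.
exfalso; move: rc; apply/negP; apply: realized_forced => //.
move: sc cc @l {uS sl}.
case: c => [|c0 [|c1 [|c2 [|c3 [|c4 [|c5 [|c6 []]]]]]]] // _.
rewrite /= !andbT => /and5P[r01 r12 r23 r34 /and3P[r45 r56 r60]].
by rewrite (r_sym c1 c0) (r_sym c2 c1) (r_sym c3 c2) (r_sym c4 c3)
  (r_sym c5 c4) (r_sym c6 c5) r01 r12 r23 r34 r45 r56 r60.
Qed.

(** Remove one independent 4-set [q]. Seven of the remaining vertices contain either a second one or
    an odd cycle; in the latter case the searches rearrange these seven vertices together with
    [q]. *)
Lemma packing2 l : uniq l -> 11 <= size l -> packing 2 l.
Proof.
move=> ul sl; have [q [uq sq iq ql]] := indep_quad ul (ltnW sl).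
set m := [seq x <- l | x \notin q].
have sm : 7 <= size m by rewrite size_removed // sq; lia.
have um : uniq m by rewrite filter_uniq.
have st : size (take 7 m) = 7 by rewrite size_takel.
have ut : uniq (take 7 m) by rewrite take_uniq.
have tm : {subset take 7 m <= m} by move=> x /mem_take.
have mq x : x \in m -> x \notin q by rewrite mem_filter => /andP[].
have ml x : x \in m -> x \in l by rewrite mem_filter => /andP[].
have utq : uniq (take 7 m ++ q).
  rewrite cat_uniq ut uq andbT; apply/hasPn => x xq.
  by apply/negP => /tm/mq/negP; apply.
have [[p [up sp ip pm]]|[c [uc sc cc cm]]] := odd_cycle_or_quad ut st.
  apply: (packing_cons uq sq iq ql).
  apply: (packing_cons up sp ip); last exact: packing0.
  by move=> x /pm/tm.
apply: (@sub_packing 2 (take 7 m ++ q)).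
  by move=> x; rewrite mem_cat => /orP[/tm/ml|/ql].
case: sc => sc; first exact: pentagon_packing utq st sq iq uc sc cc cm.
have [_ pc] : (size c = size (take 7 m)) * (c =i take 7 m).
  by apply: uniq_min_size; rewrite ?st ?sc.
have ecq : c ++ q =i take 7 m ++ q by move=> x; rewrite !mem_cat pc.
apply: (@sub_packing 2 (c ++ q)); first by move=> x; rewrite ecq.
apply: heptagon_packing => //.
by rewrite (eq_uniq _ ecq) // !size_cat sc st.
Qed.

(** Removing one 4-set at a time preserves the surplus of three vertices, down to two sets on eleven
    vertices. *)
Lemma triangle_free_packing n l :
  2 <= n -> uniq l -> 4 * n + 3 <= size l -> packing n l.
Proof.
elim: n l => // n IH l; rewrite leq_eqVlt => /predU1P[<- ul sl|n2 ul sl].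
  exact: packing2.
have [q [uq sq iq ql]] : exists q,
    [/\ uniq q, size q = 4, indep q & {subset q <= l}].
  by apply: indep_quad => //; lia.
apply: (packing_cons uq sq iq ql); apply: IH; rewrite ?filter_uniq //.
by rewrite size_removed // sq; lia.
Qed.

End TriangleFree.

(** * Triangle-free graphs of large minimum degree *)

Section Bipartition.
Variables (V : finType) (r : rel V) (d : nat).
Hypothesis r_sym : symmetric r.
Hypothesis r_tf : forall x y z, r x y -> r y z -> r z x -> False.
Hypothesis r_deg : forall x, d <= #|[set y | r x y]|.
Hypothesis d_large : 2 * #|V| < 5 * d.

Lemma card_nbrs x : #|[set y | r x y]| = \sum_y r x y.
Proof.
rewrite -sum1_card big_mkcond /=; apply: eq_bigr => y _.
by rewrite inE; case: (r x y).
Qed.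

(* A vertex has at most two neighbours on a closed 5-walk, so the degrees of
   its vertices add up to at most [2 * #|V|]. *)
Lemma no_closed_5walk a b c u v :
  r a b -> r b c -> r c u -> r u v -> r v a -> False.
Proof.
move=> ab bc cu uv va.
suff : 5 * d <= 2 * #|V| by lia.
have := leq_add (leq_add (leq_add (leq_add
  (r_deg a) (r_deg b)) (r_deg c)) (r_deg u)) (r_deg v).
rewrite !card_nbrs -!big_split /= => dl.
have le2 : \sum_y (r a y + r b y + r c y + r u y + r v y) <= \sum_(y : V) 2.
  apply: leq_sum => y _.
  have nr x z : r x z -> ~~ (r x y && r z y).
    move=> xz; apply/negP => /andP[xy zy].
    by apply: (r_tf xz zy); rewrite r_sym.
  move: (nr _ _ ab) (nr _ _ bc) (nr _ _ cu) (nr _ _ uv) (nr _ _ va).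
  by do 5!case: (r _ y).
by have := leq_trans dl le2; rewrite sum_nat_const -[#|V|]/#|xpredT|; lia.
Qed.

(** The Andrasfai-Erdos-Sos theorem for triangle-free graphs: minimum degree above 2/5 of the order
    forces bipartiteness. *)
Lemma bipartition : exists A : {set V},
  {in A &, forall x y, ~~ r x y} /\ {in ~: A &, forall x y, ~~ r x y}.
Proof.
have [a _|V0] := pickP (mem V); last first.
  by exists set0; split=> x; have := V0 x.
have [b] : exists b, b \in [set y | r a y].
  by apply/set0Pn; rewrite -card_gt0; apply: leq_trans (r_deg a); lia.
(* One side consists of the ends of 2-walks from [a]; an edge inside it would close a 5-walk through
   [a]. *)
rewrite inE => ab; exists [set x | [exists u, r a u && r u x]].
split=> x y; rewrite !inE.
  move=> /existsP[u /andP[au ux]] /existsP[w /andP[aw wy]]; apply/negP => xy.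
  by apply: (no_closed_5walk au ux xy (_ : r y w)); rewrite r_sym.
(* The neighbourhoods of [a], [b] and [z] cannot be pairwise disjoint, as [3 * d] exceeds [#|V|].
   Those of [a] and [b] are disjoint, so [z] is reached by a 2-walk from [a] or from [b]. *)
have meet z : ~~ [exists u, r a u && r u z] -> exists2 u, r b u & r u z.
  move=> nz; apply/exists_inP; apply: contraNT nz => nz.
  have d0 : [disjoint [set y | r a y] & [set y | r b y]].
    rewrite disjoints_subset; apply/subsetP => t; rewrite !inE => ta.
    by apply/negP => bt; apply: (r_tf ab bt); rewrite r_sym.
  have d1 : [disjoint [set y | r b y] & [set y | r z y]].
    rewrite disjoints_subset; apply/subsetP => t; rewrite !inE => bt.
    apply/negP => zt; case/negP: nz; apply/exists_inP; exists t => //.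
    by rewrite r_sym.
  have [d2|] := boolP [disjoint [set y | r a y] & [set y | r z y]].
    have : #|[set y | r a y] :|: [set y | r b y] :|: [set y | r z y]| <= #|V|.
      exact: max_card.
    rewrite cardsU (_ : _ :&: _ = set0); last first.
      by apply/eqP; rewrite setIUl setU_eq0 !setI_eq0 d2 d1.
    rewrite cardsU (_ : _ :&: _ = set0); last by apply/eqP; rewrite setI_eq0.
    rewrite cards0 !subn0 => cV; exfalso.
    by move: d_large (r_deg a) (r_deg b) (r_deg z); lia.
  rewrite -setI_eq0 => /set0Pn[t]; rewrite !inE => /andP[ta zt].
  by apply/existsP; exists t; rewrite ta r_sym.
move=> /meet[u bu ux] /meet[w bw wy]; apply/negP => xy.
by apply: (no_closed_5walk bu ux xy (_ : r y w)); rewrite r_sym.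
Qed.

End Bipartition.

(** * The Ramsey numbers *)

Lemma uniq_flatten_nth (T : eqType) (ss : seq (seq T)) i j x :
  uniq (flatten ss) -> x \in nth [::] ss i -> x \in nth [::] ss j -> i = j.
Proof.
have mem_fl (tt : seq (seq T)) k : x \in nth [::] tt k -> x \in flatten tt.
  move=> xk; apply/flattenP; exists (nth [::] tt k) => //.
  by case: (ltnP k (size tt)) => [/mem_nth->//|kt]; rewrite nth_default in xk.
elim: ss i j => [|s ss IH] [|i] [|j] //=; rewrite ?nth_nil ?in_nil //.
- by rewrite cat_uniq => /and3P[_ /hasPn h _] xs /mem_fl/h/negP.
- by rewrite cat_uniq => /and3P[_ /hasPn h _] /mem_fl/h/negP.
by rewrite cat_uniq => /and3P[_ _ u] xi xj; rewrite (IH i j).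
Qed.

Lemma uniq_nth_flatten (T : eqType) (ss : seq (seq T)) i :
  uniq (flatten ss) -> uniq (nth [::] ss i).
Proof.
elim: ss i => [|s ss IH] [|i] //=; rewrite cat_uniq => /and3P[us _ uss] //.
exact: IH.
Qed.

Lemma fan_copy (F : sgraph) n (v : F) (ss : seq (seq F)) : size ss = n ->
  {in ss, forall q, size q = 4 /\ {in q &, forall x y, x != y -> adj x y}} ->
  uniq (flatten ss) -> {in flatten ss, forall x, adj v x} ->
  contains_copy F (fan 4 n).
Proof.
move=> sn qss uss vss.
pose h (i : 'I_n) (j : 'I_4) := nth v (nth [::] ss i) j.
have ni (i : 'I_n) : nth [::] ss i \in ss by rewrite mem_nth // sn.
have hi (i : 'I_n) j : h i j \in nth [::] ss i.
  by rewrite mem_nth //; have [-> _] := qss _ (ni i).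
have vh i j : adj v (h i j).
  by apply: vss; apply/flattenP; exists (nth [::] ss i).
have h_inj i j i' j' : h i j = h i' j' -> i = i' /\ j = j'.
  move=> e; have ei : i = i'.
    by apply/val_inj/(uniq_flatten_nth uss (hi i j)); rewrite e hi.
  split=> //; apply/val_inj/eqP; move/eqP: e; rewrite -ei /h.
  by have [s4 _] := qss _ (ni i); rewrite nth_uniq ?s4 ?uniq_nth_flatten.
exists (fun x : fan 4 n => match x with inl _ => v | inr (i, j) => h i j end).
split.
  move=> [a|[i j]] [b|[i' j']] //=.
  - by rewrite (ord1 a) (ord1 b).
  (* The centre is adjacent to every block vertex, hence lies in no block. *)
  - by move=> e; have := vh i' j'; rewrite -e adj_irrefl.
  - by move=> e; have := vh i j; rewrite e adj_irrefl.
  by case/h_inj=> -> ->.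
move=> [a|[i j]] [b|[i' j']] /=; rewrite /complete_adj.
- by case/eqP; rewrite (ord1 a) (ord1 b).
- by move=> _; apply: vh.
- by move=> _; rewrite adj_sym.
rewrite /copies_adj /= /complete_adj => /andP[/eqP<- jj].
have [_ adjq] := qss _ (ni i); apply: adjq => //.
by apply: contra jj => /eqP/h_inj[_ ->].
Qed.

Lemma triangle_copy (F : sgraph) (x y z : F) : adj x y -> adj y z -> adj z x ->
  contains_copy F (complete 3).
Proof.
move=> xy yz zx; pose f (i : 'I_3) := nth x [:: x; y; z] i.
have f_homo : {homo f : i j / i != j >-> adj i j}.
  move=> [i i3] [j j3]; rewrite /f /=.
  case: i i3 => [|[|[|i]]] i3 //; case: j j3 => [|[|[|j]]] j3 //= _ //;
    by rewrite adj_sym.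
exists f; split=> // i j fij; apply/eqP/negPn/negP => /f_homo.
by rewrite fij adj_irrefl.
Qed.

(** * Upper bounds: colourings without a red triangle *)

Section ColoredStar.
Variable n : nat.
Hypothesis n_ge4 : 4 <= n.
Local Notation V := 'I_(8 * n).
Local Notation F := (complete_star (8 * n) (4 * n + 4)).
Variable c : {set F} -> bool.
Local Notation red := (color_adj c true).
Local Notation blue := (color_adj c false).
Local Notation blue_fan := (contains_copy (color_class c false) (fan 4 n)).
Hypothesis red_tf : forall x y z : F, red x y -> red y z -> red z x -> False.

(** The red graph without the extra vertex [None], which enters only at the end. *)
Let r : rel V := fun i j => red (Some i) (Some j).

Let r_sym : symmetric r.
Proof. by move=> i j; apply: color_sym. Qed.

Let r_tf i j k : r i j -> r j k -> r k i -> False.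
Proof. exact: red_tf. Qed.

Lemma blue_nonred (i j : V) : i != j -> ~~ r i j -> blue (Some i) (Some j).
Proof. by rewrite /r /color_adj /= => -> /=; case: (c _). Qed.

Lemma blue_packing k (l : seq V) : packing r k l -> exists ss : seq (seq F),
  [/\ size ss = k,
      {in ss, forall q, size q = 4 /\ {in q &, forall x y, x != y -> blue x y}},
      uniq (flatten ss) & {subset flatten ss <= map Some l}].
Proof.
case=> ss [sss qss uss ssl]; exists (map (map Some) ss).
rewrite -map_flatten size_map map_inj_uniq; last by move=> ? ? [].
split=> //; last by move=> _ /mapP[x /ssl xl ->]; apply: map_f.
move=> _ /mapP[q /qss[sq iq] ->]; rewrite size_map; split=> //.
move=> _ _ /mapP[x xq ->] /mapP[y yq ->] xy.
by apply: blue_nonred => //; apply: iq.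
Qed.

Lemma packing_fan (v : V) (l : seq V) : packing r n l -> v \notin l ->
  {in l, forall x, ~~ r v x} -> blue_fan.
Proof.
move=> /blue_packing[ss [sss qss uss ssl]] vl lv.
apply: (@fan_copy (color_class c false) n (Some v) ss sss qss uss).
move=> x /ssl/mapP[y yl ->]; apply: blue_nonred; last exact: lv.
by apply: contraNneq vl => ->.
Qed.

(** Such a set is a blue clique on at least [4 * n + 1] vertices: any one of them is the centre, and
    the others split into 4-sets. *)
Lemma indep_fan (A : {set V}) :
  {in A &, forall x y, ~~ r x y} -> 4 * n < #|A| -> blue_fan.
Proof.
move=> iA; rewrite cardE => sA.
have mA x : x \in enum A -> x \in A by rewrite mem_enum.
case: (enum A) (enum_uniq A) sA mA => [|v l] //= /andP[vl ul] sl mA.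
apply: (@packing_fan v l) => //.
  apply: indep_packing => // x y xl yl.
  by apply: iA; apply: mA; rewrite inE ?xl ?yl orbT.
by move=> x xl; apply: iA; apply: mA; rewrite inE ?xl ?eqxx ?orbT.
Qed.

(** At least [8 * n - 1 - (4 * n - 4) = 4 * n + 3] vertices are joined to [v] in blue, enough for a
    packing of [n] sets. *)
Lemma low_degree_fan v : #|[set y | r v y]| <= 4 * n - 4 -> blue_fan.
Proof.
move=> dv; apply: (@packing_fan v (enum [set y | (y != v) && ~~ r v y])).
- apply: (triangle_free_packing r_sym r_tf);
    [lia | exact: enum_uniq | rewrite -cardE].
  have -> : [set y | (y != v) && ~~ r v y] = ~: (v |: [set y | r v y]).
    by apply/setP => y; rewrite !inE negb_or.
  rewrite cardsCs setCK card_ord; have := leq_card_setU [set v] [set y | r v y].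
  by rewrite cards1 => -[]; lia.
- by rewrite mem_enum inE eqxx.
by move=> x; rewrite mem_enum inE => /andP[].
Qed.

(** The centre is a blue neighbour [a0] of [None]. One block is [None] with three further blue
    neighbours, and the other [4 * n - 4] vertices of [X] give [n - 1] blocks. *)
Lemma star_fan (X : {set V}) : {in X &, forall x y, ~~ r x y} ->
  #|X| = 4 * n -> 4 <= #|[set x in X | blue None (Some x)]| -> blue_fan.
Proof.
move=> iX cX; rewrite cardE; set bs := enum _ => sb.
have ub : uniq bs by apply: enum_uniq.
have bP x : x \in bs -> x \in X /\ blue None (Some x).
  by rewrite mem_enum inE => /andP[].
case: bs sb ub bP => [|a0 [|a1 [|a2 [|a3 bs]]]] // _ ub bP.
pose q3 := [:: a1; a2; a3]; pose q := a0 :: q3.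
have qP x : x \in q -> x \in X /\ blue None (Some x).
  by move=> xq; apply: bP; rewrite -[_ :: _]/(q ++ bs) mem_cat xq.
have uq : uniq q by move: ub; rewrite -[_ :: _]/(q ++ bs) cat_uniq => /andP[].
have /andP[a0q3 uq3] : (a0 \notin q3) && uniq q3 := uq.
have q3q x : x \in q3 -> x \in q by move=> xq; rewrite in_cons xq orbT.
have a0q : a0 \in q by rewrite in_cons eqxx.
have sX x : x \in [seq x <- enum X | x \notin q] -> x \in X.
  by rewrite mem_filter mem_enum => /andP[].
have : packing r n.-1 [seq x <- enum X | x \notin q].
  apply: indep_packing; first by rewrite filter_uniq ?enum_uniq.
    by move=> x y /sX xX /sX; apply: iX.
  rewrite size_removed ?enum_uniq // -?cardE ?cX /=; first lia.
  by move=> x /qP[xX _]; rewrite mem_enum.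
case/blue_packing=> ss [sss qss uss ssl].
have bX i j : i \in q -> j \in X -> i != j -> blue (Some i) (Some j).
  by move=> /qP[iX' _] jX ij; apply: blue_nonred => //; apply: iX.
have nb i : i \in q -> blue None (Some i) by move/qP=> [].
apply: (@fan_copy (color_class c false) n (Some a0)
  ((None :: map Some q3) :: ss)).
- by rewrite /= sss prednK //; apply: leq_trans n_ge4.
- move=> q'; rewrite inE => /predU1P[->|/qss//]; split=> // x y.
  rewrite !(in_cons None); case/predU1P=> [->|/mapP[i iq ->]].
    by case/predU1P=> [->|/mapP[j jq ->]] // _; apply/nb/q3q.
  case/predU1P=> [->|/mapP[j jq ->]].
    by move=> _; rewrite adj_sym; apply/nb/q3q.
  move=> ij; apply: bX; [exact: q3q | by case: (qP j (q3q j jq)) |].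
  by apply: contra ij => /eqP->.
- rewrite -[flatten _]/((None :: map Some q3) ++ flatten ss) cat_uniq uss andbT.
  apply/andP; split.
    rewrite cons_uniq map_inj_uniq ?uq3 ?andbT; last by move=> ? ? [].
    by apply/mapP => -[].
  apply/hasPn => x /ssl/mapP[i + ->]; rewrite mem_filter => /andP[iq _].
  rewrite in_cons negb_or; apply/andP; split=> //.
  by apply: contra iq => /mapP[j jq [->]]; apply: q3q.
move=> x; rewrite -[flatten _]/(None :: (map Some q3 ++ flatten ss)).
rewrite in_cons mem_cat.
case/or3P=> [/eqP->|/mapP[i iq ->]|/ssl/mapP[i iq ->]].
- by rewrite adj_sym; apply: nb.
- apply: bX => //; first by case: (qP i (q3q i iq)).
  by apply: contraNneq a0q3 => ->.
apply: bX => //; first exact: sX.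
by move: iq; rewrite mem_filter => /andP[iq _]; apply: contraNneq iq => <-.
Qed.

Lemma card_star_nbrs (X : {set V}) : #|[set i : V | i < 4 * n + 4] :&: X| <=
  #|[set x in X | red None (Some x)]| + #|[set x in X | blue None (Some x)]|.
Proof.
apply: leq_trans (leq_card_setU _ _).1; apply: subset_leq_card.
apply/subsetP => i; rewrite !inE => /andP[iW iX].
by rewrite iX /color_adj /= iW /=; case: (c _).
Qed.

(** For a red neighbour [a] of [None] in [X], the red neighbours of [a] all lie in [~: X] and avoid
    those of [None], which leaves at most [4 * n - (4 * n - 3) = 3] places. *)
Lemma card_red_star_nbrs (X : {set V}) : {in X &, forall x y, ~~ r x y} ->
  (forall v, 4 * n - 3 <= #|[set y | r v y]|) -> #|~: X| <= 4 * n ->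
  0 < #|[set x in X | red None (Some x)]| ->
  #|[set x in ~: X | red None (Some x)]| <= 3.
Proof.
move=> iX deg cY /card_gt0P[a]; rewrite inE => /andP[aX wa].
set R := [set x in ~: X | _].
have dis : [set y | r a y] :&: R = set0.
  apply/eqP; rewrite setI_eq0 disjoints_subset.
  apply/subsetP => y; rewrite !inE => ay.
  apply/negP => /andP[_ wy]; apply: (red_tf wa ay).
  by rewrite color_sym.
have : [set y | r a y] :|: R \subset ~: X.
  apply/subsetP => y; rewrite !inE => /orP[ay|/andP[]//].
  by apply: contraL ay; apply: iX.
move=> /subset_leq_card; rewrite cardsU dis cards0 subn0 => le.
have := leq_trans (leq_trans (leq_add (deg a) (leqnn #|R|)) le) cY.
by move: #|R| => k; lia.
Qed.

Lemma triangle_free_fan : blue_fan.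
Proof.
have [/existsP[v /low_degree_fan//]|] :=
  boolP [exists v, #|[set y | r v y]| <= 4 * n - 4].
rewrite negb_exists => /forallP ndeg.
have deg v : 4 * n - 3 <= #|[set y | r v y]| by have := ndeg v; lia.
(* The degree condition reads [16 * n < 20 * n - 15], which is where [n >= 4] is needed. *)
have [] := bipartition r_sym r_tf deg; first by rewrite card_ord; lia.
move=> A [iA iB].
have [?|cA] := ltnP (4 * n) #|A|; first exact: indep_fan iA _.
have [?|cB] := ltnP (4 * n) #|~: A|; first exact: indep_fan iB _.
have cAB : #|A| + #|~: A| = 8 * n by rewrite cardsC card_ord.
have eA : #|A| = 4 * n by lia.
have eB : #|~: A| = 4 * n by lia.
have [?|bA] := leqP 4 #|[set x in A | blue None (Some x)]|.
  exact: star_fan iA _ _.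
have [?|bB] := leqP 4 #|[set x in ~: A | blue None (Some x)]|.
  exact: star_fan iB _ _.
(* Each part holds at most three blue neighbours of [None]. With red neighbours in both parts,
   [None] has at most 12 neighbours, fewer than [4 * n + 4]; with none in one part, the other part
   must hold [4 * n + 1] of them, more than its size. *)
exfalso; set W := [set i : V | i < 4 * n + 4].
have cW : #|W| = 4 * n + 4.
  rewrite -sum1_card (eq_bigl (fun i : V => i < 4 * n + 4)); last first.
    by move=> i; rewrite inE.
  rewrite -(big_ord_widen (8 * n) (fun=> 1)); last lia.
  by rewrite sum_nat_const card_ord muln1.
have := cardsID A W; rewrite setDE cW => cWA.
have := card_red_star_nbrs iA deg cB.
have := card_red_star_nbrs iB deg; rewrite setCK => /(_ cA).
have := subset_leq_card (subsetIr W A).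
have := subset_leq_card (subsetIr W (~: A)).
move: (card_star_nbrs A) (card_star_nbrs (~: A)) bA bB cWA; rewrite -/W eA eB.
move: #|W :&: A| #|W :&: ~: A| #|[set x in A | red None (Some x)]|.
move: #|[set x in ~: A | red None (Some x)]|.
move: #|[set x in A | blue None (Some x)]|.
move: #|[set x in ~: A | blue None (Some x)]|.
by clear -n_ge4; lia.
Qed.

End ColoredStar.

Lemma star_arrows n : 4 <= n ->
  arrows (complete_star (8 * n) (4 * n + 4)) (complete 3) (fan 4 n).
Proof.
move=> n4 c; pose red := color_adj c true.
have [/existsP[x /existsP[y /existsP[z /and3P[xy yz zx]]]]|ntri] :=
  boolP [exists x, exists y, exists z, [&& red x y, red y z & red z x]].
  by left; apply: (@triangle_copy (color_class c true) x y z).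
right; apply: triangle_free_fan => // x y z xy yz zx; case/negP: ntri.
apply/existsP; exists x; apply/existsP; exists y; apply/existsP; exists z.
exact/and3P.
Qed.

(** A colouring of the larger graph is pulled back along the embedding. *)
Lemma arrows_copy (F F' G H : sgraph) :
  contains_copy F' F -> arrows F G H -> arrows F' G H.
Proof.
move=> [f [f_inj f_homo]] FGH c.
have lift b K : contains_copy (color_class (fun S => c (f @: S)) b) K ->
    contains_copy (color_class c b) K.
  move=> [g [g_inj g_homo]]; exists (f \o g); split; first exact: inj_comp.
  move=> x y /g_homo /andP[/f_homo fxy]; rewrite imsetU !imset_set1 => cxy.
  by rewrite /= /color_adj fxy.
by case: (FGH (fun S => c (f @: S))) => /lift; [left | right].
Qed.

(** Through this embedding the star bound also yields the bound on the Ramsey number. *)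
Lemma complete_star_copy N k :
  contains_copy (complete (N + 1)) (complete_star N k).
Proof.
exists (fun x : complete_star N k =>
  if x is Some i then lshift 1 i else rshift N ord0 : 'I_(N + 1)).
split=> [[i|] [j|]|[i|] [j|]] //=; rewrite /complete_adj.
- by move/lshift_inj->.
- by move/eqP; rewrite eq_lrshift.
- by move/eqP; rewrite eq_rlshift.
- by rewrite eq_lrshift.
by rewrite eq_rlshift.
Qed.

(** * Lower bounds: colourings by a cut, red across and blue within the sides *)

Definition cut_coloring (F : sgraph) (side : F -> bool) (S : {set F}) : bool :=
  [exists x in S, exists y in S, side x != side y].

Lemma cut_coloringE (F : sgraph) (side : F -> bool) x y :
  cut_coloring side [set x; y] = (side x != side y).
Proof.
apply/exists_inP/idP => [[u + /exists_inP[v]]|xy].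
  rewrite !inE => /orP[] /eqP-> /orP[] /eqP->; rewrite ?eqxx //.
  by rewrite eq_sym.
by exists x; rewrite ?set21 //; apply/exists_inP; exists y; rewrite ?set22.
Qed.

Lemma cut_no_triangle (F : sgraph) (side : F -> bool) :
  ~ contains_copy (color_class (cut_coloring side) true) (complete 3).
Proof.
move=> [f [_ f_homo]].
have f2 (i j : 'I_3) : i != j -> side (f i) != side (f j).
  by move=> /f_homo /andP[_]; rewrite cut_coloringE eqb_id.
have := f2 ord0 (lift ord0 ord0) isT; have := f2 ord0 ord_max isT.
have := f2 (lift ord0 ord0) ord_max isT.
by do 3!case: (side _).
Qed.

(** Blue edges do not cross the cut, and the centre is adjacent to all other vertices. *)
Lemma cut_fan_side (F : sgraph) (side : F -> bool) n (f : fan 4 n -> F) :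
  {homo f : x y / adj x y >-> color_adj (cut_coloring side) false x y} ->
  forall x, side (f x) = side (f (inl ord0)).
Proof.
move=> f_homo [a|ij]; first by rewrite (ord1 a).
have /andP[_] : color_adj (cut_coloring side) false (f (inr ij)) (f (inl ord0)).
  exact: f_homo.
by rewrite cut_coloringE eqbF_neg negbK => /eqP.
Qed.

Lemma card_fan n : #|fan 4 n| = 4 * n + 1.
Proof. by rewrite card_sum card_prod !card_ord addnC mulnC. Qed.

Lemma cut_fan_card (F : sgraph) (side : F -> bool) n :
  contains_copy (color_class (cut_coloring side) false) (fan 4 n) ->
  exists b, 4 * n < #|[set x : F | side x == b]|.
Proof.
move=> [f [f_inj f_homo]]; exists (side (f (inl ord0))).
rewrite -addn1 -card_fan -(card_imset predT f_inj); apply: subset_leq_card.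
by apply/subsetP => _ /imsetP[x _ ->]; rewrite inE (cut_fan_side f_homo).
Qed.

(** Every vertex lies in a K_5 made of the centre and one block, parametrized by [h] with [None] for
    the centre. *)
Lemma fan_degree n (z : fan 4 n) : 0 < n -> 4 <= #|[set y | adj z y]|.
Proof.
move=> n0; have [i [o ->]] : exists (i : 'I_n) (o : option 'I_4),
    z = if o is Some j then inr (i, j) else inl ord0.
  case: z => [a|[i j]]; last by exists i, (Some j).
  by exists (Ordinal n0), None; rewrite (ord1 a).
pose h (o : option 'I_4) : fan 4 n :=
  if o is Some j then inr (i, j) else inl ord0.
have h_inj : injective h by move=> [j|] [k|] //= [->].
have h_adj p : p != o -> adj (h o) (h p).
  case: o p => [j|] [k|] //= jk; rewrite /copies_adj /= eqxx /=.
  by rewrite /complete_adj eq_sym.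
have c4 : #|[set p | p != o]| = 4 by rewrite cardsE cardC1 card_option card_ord.
rewrite -[X in X <= _]c4 -(card_imset _ h_inj); apply: subset_leq_card.
by apply/subsetP => _ /imsetP[p + ->]; rewrite !inE => /h_adj.
Qed.

Lemma card_ord_interval N a b : #|[set i : 'I_N | a <= i < b]| <= b - a.
Proof.
rewrite cardE -(size_map val) -[X in _ <= X](size_iota a).
apply: uniq_leq_size; first by rewrite (map_inj_uniq val_inj) enum_uniq.
by move=> _ /mapP[i + ->]; rewrite mem_enum inE mem_iota /=; lia.
Qed.

Lemma card_ord_side N n b : N <= 8 * n ->
  #|[set i : 'I_N | (i < 4 * n) == b]| <= 4 * n.
Proof.
move=> N8; have [e1 e2] : 4 * n - 0 = 4 * n /\ 8 * n - 4 * n = 4 * n by lia.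
case: b; [rewrite -[X in _ <= X]e1 | rewrite -[X in _ <= X]e2];
  apply: leq_trans (card_ord_interval N _ _); apply: subset_leq_card;
  apply/subsetP => i; rewrite !inE; have := ltn_ord i; lia.
Qed.

Lemma complete_not_arrows n m : m <= 8 * n ->
  ~ arrows (complete m) (complete 3) (fan 4 n).
Proof.
move=> m8 /(_ (@cut_coloring (complete m) (fun i : 'I_m => i < 4 * n))).
case=> [/cut_no_triangle//|/cut_fan_card[b]].
by rewrite ltnNge card_ord_side.
Qed.

(** The extra vertex is put on the side opposite to the vertices below [4 * n], so its blue
    neighbours are those from [4 * n] to [k - 1], at most three, against degree at least 4 in the
    fan. A blue fan avoiding it would fit in [4 * n] vertices. *)
Lemma star_not_arrows n k : 0 < n -> k < 4 * n + 4 ->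
  ~ arrows (complete_star (8 * n) k) (complete 3) (fan 4 n).
Proof.
move=> n0 k4; pose F := complete_star (8 * n) k.
pose side (x : F) := if x is Some i then (i : 'I_(8 * n)) < 4 * n else false.
case/(_ (cut_coloring side)) => [/cut_no_triangle//|[f [f_inj f_homo]]].
have cS (S : {set 'I_(8 * n)}) : #|Some @: S| = #|S|.
  by apply: card_imset => ? ? [].
have [/existsP[z /eqP fz]|nN] := boolP [exists z, f z == None]; last first.
  have : #|f @: setT| <= #|Some @: [set i : 'I_(8 * n) |
                              (i < 4 * n) == side (f (inl ord0))]|.
    apply: subset_leq_card; apply/subsetP => _ /imsetP[x _ ->].
    have := cut_fan_side f_homo x; case E: (f x) => [i|]; last first.
      by case/existsP: nN; exists x; rewrite E.
    by move=> <-; apply: imset_f; rewrite inE.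
  rewrite cS card_imset // cardsT card_fan.
  move=> /leq_trans/(_ (card_ord_side _ (leqnn _))).
  by rewrite addn1 ltnn.
have := fan_degree z n0; rewrite -(card_imset _ f_inj).
have /subset_leq_card : f @: [set y | adj z y] \subset
    Some @: [set i : 'I_(8 * n) | 4 * n <= i < k].
  apply/subsetP => _ /imsetP[y + ->]; rewrite inE => /f_homo /andP[].
  rewrite fz cut_coloringE; case: (f y) => [i|] //= ik.
  rewrite eqbF_neg negbK => /eqP i4.
  by apply: imset_f; rewrite inE ik leqNgt -i4.
move=> + /leq_trans => /[swap]/[apply]; rewrite cS.
by move=> /leq_trans/(_ (card_ord_interval _ _ _)); lia.
Qed.

Theorem theorem1p5 (n : nat) (hn : 4 <= n) :
  ramsey_number (complete 3) (fan 4 n) (8 * n + 1) /\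
  star_critical_ramsey_number (complete 3) (fan 4 n) (4 * n + 4).
Proof.
have ram : ramsey_number (complete 3) (fan 4 n) (8 * n + 1).
  split=> [|m mP]; last first.
    by rewrite addn1 ltnNge; apply/negP => /complete_not_arrows/(_ mP).
  exact: arrows_copy (complete_star_copy _ _) (star_arrows hn).
split=> //; exists (8 * n + 1) => //; rewrite addn1 /=.
(* The range condition here is [4 * n + 4 <= 8 * n]. *)
split=> [|k [_ kP]]; first by split; [lia | exact: star_arrows].
rewrite leqNgt; apply/negP => /star_not_arrows-/(_ (leq_trans _ hn)).
by apply.
Qed.
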